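(* The critical points of the scaling foliation of $\Sigma$, i.e. the points $\mathbf{u}\in\Sigma$ with $Z_{\mathbf{u}}=0$, are given by the union of the $W$-orbits of $P$, of $C_+$ and of $C_-$.
   Context: The parameter space is $\Sigma=T^3$, with points $\mathbf{u}=(e^{i\varphi_1},e^{i\varphi_2},e^{i\varphi_3})$. For $\mathbf{u}\in\Sigma$, consider the quadratic algebra generated by four hermitian elements $x^0,x^1,x^2,x^3$ with relations $$\cos(\varphi_k)[x^0,x^k]_-=i\sin(\varphi_\ell-\varphi_m)[x^\ell,x^m]_+,\qquad \cos(\varphi_\ell-\varphi_m)[x^\ell,x^m]_-=-i\sin(\varphi_k)[x^0,x^k]_+$$ for every cyclic permutation $(k,\ell,m)$ of $(1,2,3)$, where $[x,y]_\pm=xy\pm yx$. Two points of $\Sigma$ are called scale-equivalent when the corresponding quadratic algebras are isomorphic. This generates a foliation of $\Sigma$, the scaling foliation, which is described by the orbits of the flow of the vector field $$Z=\sum_{k=1}^3\sin(2\varphi_k)\,\sin(\varphi_\ell+\varphi_m-\varphi_k)\,\frac{\partial}{\partial\varphi_k},$$ where $\{k,\ell,m\}=\{1,2,3\}$ in each term. In the coordinates $(\varphi_1,\varphi_2,\varphi_3)$: $P=(\frac{\pi}{2},\frac{\pi}{2},\frac{\pi}{2})$, and $C_+$, $C_-$ are the circles $$C_+=\{\mathbf{u}\in\Sigma:\varphi_1=\varphi_2,\ \varphi_3=0\},\qquad C_-=\{\mathbf{u}\in\Sigma:\varphi_1=\tfrac{\pi}{2}+\varphi_3,\ \varphi_2=\tfrac{\pi}{2}\}.$$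 $W$ is the group of transformations of $\Sigma$ generated by the permutations of $(\varphi_1,\varphi_2,\varphi_3)$ and by the transformation $w(\varphi_1,\varphi_2,\varphi_3)=(-\varphi_1,\varphi_3-\varphi_1,\varphi_2-\varphi_1)$.
   Formalization: Membership in the union of the W-orbits of P, C_+ and C_- is taken up to signs of the coordinates of u (angles modulo π); modulo 2π the claim fails, e.g. (π,π,π) is a zero of Z lying in none of these orbits. *)

(* Defs.v *)
(* Stdlib reals, with the complex numbers of Coquelicot. *)
From Stdlib Require Import Reals Lra ProofIrrelevance.
From Coquelicot Require Import Coquelicot.
Open Scope R_scope.

Definition circle : Type := {z : C | Cmod z = 1}.

Lemma circle_eq (a b : circle) : proj1_sig a = proj1_sig b -> a = b.
Proof.
destruct a as [a Ha], b as [b Hb]; simpl; intros ->.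
now rewrite (proof_irrelevance _ Ha Hb).
Qed.

Lemma Cmod_expi (t : R) : Cmod (cos t, sin t) = 1.
Proof.
unfold Cmod; simpl.
replace (_ + _) with 1; [exact sqrt_1|].
generalize (sin2_cos2 t); unfold Rsqr; lra.
Qed.

Definition expi (t : R) : circle := exist _ (cos t, sin t) (Cmod_expi t).

Lemma Cmod_circle_mul (a b : circle) :
  Cmod (Cmult (proj1_sig a) (proj1_sig b)) = 1.
Proof. rewrite Cmod_mult, (proj2_sig a), (proj2_sig b); ring. Qed.

Definition cmul (a b : circle) : circle := exist _ _ (Cmod_circle_mul a b).

Lemma Cmod_circle_inv (a : circle) : Cmod (Cconj (proj1_sig a)) = 1.
Proof. rewrite Cmod_conj; exact (proj2_sig a). Qed.

(* On the unit circle the inverse is the complex conjugate. *)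
Definition cinv (a : circle) : circle := exist _ _ (Cmod_circle_inv a).

Lemma cmul_expi (s t : R) : cmul (expi s) (expi t) = expi (s + t).
Proof.
apply circle_eq; simpl; rewrite cos_plus, sin_plus; unfold Cmult; simpl.
f_equal; ring.
Qed.

Lemma cinv_expi (t : R) : cinv (expi t) = expi (- t).
Proof. now apply circle_eq; simpl; rewrite cos_neg, sin_neg. Qed.

Definition Sigma : Type := (circle * circle * circle)%type.

Definition pt (p1 p2 p3 : R) : Sigma := (expi p1, expi p2, expi p3).

(* The component of Zvec along d/d(phi_k), as a function of
   (phi_k, phi_l, phi_m); it is symmetric in l and m. *)
Definition Zcomp (pk pl pm : R) : R := sin (2 * pk) * sin (pl + pm - pk).

(* The components of Zvec in the frame (d/d(phi_1), d/d(phi_2), d/d(phi_3)). *)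
Definition Zvec (p1 p2 p3 : R) : R * R * R :=
  (Zcomp p1 p2 p3, Zcomp p2 p3 p1, Zcomp p3 p1 p2).

(* Zvec is a vector field on Sigma: its components at u do not depend on the
   angles chosen to represent u. *)
Lemma Z_well_defined (p1 p2 p3 q1 q2 q3 : R) :
  pt p1 p2 p3 = pt q1 q2 q3 -> Zvec p1 p2 p3 = Zvec q1 q2 q3.
Proof.
unfold pt, expi; intros H; injection H; intros S3 C3 S2 C2 S1 C1.
unfold Zvec, Zcomp; rewrite !sin_2a, !sin_minus, !sin_plus, !cos_plus.
now rewrite S1, S2, S3, C1, C2, C3.
Qed.

Definition critical (u : Sigma) : Prop :=
  exists p1 p2 p3 : R, u = pt p1 p2 p3 /\ Zvec p1 p2 p3 = (0, 0, 0).

Definition pointP : Sigma := pt (PI / 2) (PI / 2) (PI / 2).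

Definition C_plus (u : Sigma) : Prop :=
  exists p1 p2 p3 : R, u = pt p1 p2 p3 /\ p1 = p2 /\ p3 = 0.

Definition C_minus (u : Sigma) : Prop :=
  exists p1 p2 p3 : R, u = pt p1 p2 p3 /\ p1 = PI / 2 + p3 /\ p2 = PI / 2.

Definition w (u : Sigma) : Sigma :=
  let '(u1, u2, u3) := u in (cinv u1, cmul u3 (cinv u1), cmul u2 (cinv u1)).

Lemma w_pt (p1 p2 p3 : R) : w (pt p1 p2 p3) = pt (- p1) (p3 - p1) (p2 - p1).
Proof. unfold w, pt; now rewrite !cinv_expi, !cmul_expi. Qed.

Inductive coord_perm : (Sigma -> Sigma) -> Prop :=
| perm_123 : coord_perm (fun '(u1, u2, u3) => (u1, u2, u3))
| perm_132 : coord_perm (fun '(u1, u2, u3) => (u1, u3, u2))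
| perm_213 : coord_perm (fun '(u1, u2, u3) => (u2, u1, u3))
| perm_231 : coord_perm (fun '(u1, u2, u3) => (u2, u3, u1))
| perm_312 : coord_perm (fun '(u1, u2, u3) => (u3, u1, u2))
| perm_321 : coord_perm (fun '(u1, u2, u3) => (u3, u2, u1)).

Inductive W : (Sigma -> Sigma) -> Prop :=
| W_perm f : coord_perm f -> W f
| W_w : W w
| W_id : W (fun u => u)
| W_comp f g : W f -> W g -> W (fun u => f (g u))
| W_inv f g : W f -> (forall u, g (f u) = u) -> (forall u, f (g u) = u) -> W g.

Definition W_orbit (A : Sigma -> Prop) (u : Sigma) : Prop :=
  exists (g : Sigma -> Sigma) (v : Sigma), W g /\ A v /\ u = g v.

Definition copp (a : circle) : circle := cmul (expi PI) a.

(* phi_k = psi_k modulo PI for every k: u and v differ by the signs of their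
   coordinates.  Replacing phi_k by phi_k + PI in the relations of the
   quadratic algebra amounts to replacing x^0 by -x^0, so such u and v have
   isomorphic algebras; Zvec is multiplied by -1, so its zeros are preserved.
   W permutes the classes of this relation, but an orbit of W itself is not a
   union of classes: (PI, PI, PI) is a zero of Zvec, and it is not in the
   W-orbit of pointP, of C_plus or of C_minus unless angles are taken modulo PI. *)
Definition eq_mod_signs (u v : Sigma) : Prop :=
  let '(u1, u2, u3) := u in
  let '(v1, v2, v3) := v in
  (u1 = v1 \/ u1 = copp v1) /\
  (u2 = v2 \/ u2 = copp v2) /\
  (u3 = v3 \/ u3 = copp v3).

(* Main.v *)
Require Import Defs.
From Stdlib Require Import Reals Lra.
From Coquelicot Require Import Coquelicot.

(** The angles [t] with [sin t = 0] form the subgroup [PI * Z] of [R], and [Z = 0] says that for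
    each [k] one of [2 phi_k], [phi_l + phi_m - phi_k] lies in it.  If the second alternative
    holds for two indices, adding (or subtracting) the two conditions puts [2 phi_k] in [PI * Z]
    for the third index [k]: modulo [PI], [phi_k] is [0] or [PI / 2], and [u] lies on a
    permutation of [C_plus] or [C_minus].  Otherwise every [2 phi_k] is in [PI * Z], which leaves
    eight points modulo [PI]: [P], the three permutations of [w P], and four points of the
    circles.  Conversely, [P], [C_plus] and [C_minus] consist of zeros of [Z], and the zero set
    is stable under [W]; since [w] is an involution, one inclusion is enough for [w]. *)

Definition critical_orbits (u : Sigma) : Prop :=
  exists v : Sigma,
    eq_mod_signs u v /\
    (W_orbit (fun x : Sigma => x = pointP) v \/ W_orbit C_plus v \/ W_orbit C_minus v).

(** * Angles modulo [PI] and points of [Sigma] *)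

Lemma sin_plus_eq_0 (x y : R) : sin x = 0 -> sin y = 0 -> sin (x + y) = 0.
Proof. intros Hx Hy; rewrite sin_plus, Hx, Hy; ring. Qed.

Lemma sin_minus_eq_0 (x y : R) : sin x = 0 -> sin y = 0 -> sin (x - y) = 0.
Proof. intros Hx Hy; rewrite sin_minus, Hx, Hy; ring. Qed.

(** Both alternatives are written as differences, [a - 0] included, to fit the hypotheses of
    [eq_mod_signs_pt]. *)
Lemma sin_double_eq_0 (a : R) :
  sin (2 * a) = 0 -> sin (a - 0) = 0 \/ sin (a - PI / 2) = 0.
Proof.
rewrite sin_2a, Rminus_0_r, sin_minus, cos_PI2, sin_PI2; intros H.
destruct (Rmult_integral _ _ H) as [H1|H1]; [left|right]; lra.
Qed.

Lemma Zcomp_eq_0 (pk pl pm : R) :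
  Zcomp pk pl pm = 0 <-> sin (2 * pk) = 0 \/ sin (pl + pm - pk) = 0.
Proof.
unfold Zcomp; split; [apply Rmult_integral | intros [-> | ->]; ring].
Qed.

Lemma expi_surj (a : circle) : exists t, a = expi t.
Proof.
destruct a as [[x y] H].
assert (Hxy : x * x + y * y = 1).
{ assert (E := f_equal (fun t => t * t) H); unfold Cmod in E; simpl in E.
  rewrite sqrt_sqrt in E by nra; lra. }
assert (Hc : cos (acos x) = x) by (apply cos_acos; nra).
assert (Hs : sin (acos x) = Rabs y).
{ rewrite sin_acos by nra; rewrite <- sqrt_Rsqr_abs; f_equal; unfold Rsqr; lra. }
destruct (Rle_dec 0 y) as [Hy|Hy].
- exists (acos x); apply circle_eq; simpl.
  now rewrite Hc, Hs, Rabs_pos_eq.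
- exists (- acos x); apply circle_eq; simpl.
  rewrite cos_neg, sin_neg, Hc, Hs, Rabs_left by lra; f_equal; lra.
Qed.

Lemma pt_surj (u : Sigma) : exists p1 p2 p3, u = pt p1 p2 p3.
Proof.
destruct u as [[u1 u2] u3].
destruct (expi_surj u1) as [p1 ->], (expi_surj u2) as [p2 ->], (expi_surj u3) as [p3 ->].
now exists p1, p2, p3.
Qed.

Lemma copp_expi (t : R) : copp (expi t) = expi (t + PI).
Proof. unfold copp; rewrite cmul_expi; f_equal; ring. Qed.

(** A vanishing sine forces [cos (a - b)] to be 1 or -1; the addition formulas for [a = (a - b) + b]
    then give the sign. *)
Lemma expi_eq_mod_sign (a b : R) :
  sin (a - b) = 0 -> expi a = expi b \/ expi a = copp (expi b).
Proof.
intros H.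
assert (H2 := sin2_cos2 (a - b)); rewrite H in H2; unfold Rsqr in H2.
assert (E : (cos (a - b) - 1) * (cos (a - b) + 1) = 0) by lra.
assert (Hc := cos_plus (a - b) b); assert (Hs := sin_plus (a - b) b).
replace (a - b + b) with a in * by ring; rewrite H in Hc, Hs.
rewrite copp_expi.
destruct (Rmult_integral _ _ E) as [E1|E1]; [left|right]; apply circle_eq; simpl.
- replace (cos (a - b)) with 1 in * by lra; f_equal; lra.
- replace (cos (a - b)) with (-1) in * by lra.
  rewrite neg_cos, neg_sin; f_equal; lra.
Qed.

Lemma eq_mod_signs_pt (a b c a' b' c' : R) :
  sin (a - a') = 0 -> sin (b - b') = 0 -> sin (c - c') = 0 ->
  eq_mod_signs (pt a b c) (pt a' b' c').
Proof.
intros Ha Hb Hc; repeat split; now apply expi_eq_mod_sign.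
Qed.

(** * Stability of the zero set under [W] and under signs *)

Lemma critical_pt (p1 p2 p3 : R) :
  critical (pt p1 p2 p3) <->
  Zcomp p1 p2 p3 = 0 /\ Zcomp p2 p3 p1 = 0 /\ Zcomp p3 p1 p2 = 0.
Proof.
transitivity (Zvec p1 p2 p3 = (0, 0, 0)).
- split; [intros (q1 & q2 & q3 & E & <-) | intros H; exists p1, p2, p3; easy].
  now apply Z_well_defined.
- unfold Zvec; split; [intros H; injection H; auto | now intros (-> & -> & ->)].
Qed.

Lemma Zcomp_sym (pk pl pm : R) : Zcomp pk pl pm = Zcomp pk pm pl.
Proof. unfold Zcomp; do 2 f_equal; ring. Qed.

Lemma critical_perm (f : Sigma -> Sigma) (u : Sigma) :
  coord_perm f -> critical (f u) <-> critical u.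
Proof.
destruct (pt_surj u) as (p1 & p2 & p3 & ->).
intros []; unfold pt; fold (pt p1 p2 p3) (pt p1 p3 p2) (pt p2 p1 p3)
  (pt p2 p3 p1) (pt p3 p1 p2) (pt p3 p2 p1); rewrite !critical_pt;
rewrite ?(Zcomp_sym p1 p3 p2), ?(Zcomp_sym p2 p1 p3), ?(Zcomp_sym p3 p2 p1); tauto.
Qed.

Lemma w_involutive (u : Sigma) : w (w u) = u.
Proof.
destruct (pt_surj u) as (p1 & p2 & p3 & ->).
rewrite !w_pt; f_equal; ring.
Qed.

Ltac sin_eq_0 H := rewrite <- H; f_equal; ring.

(** Up to sign, [w] fixes [2 * a] and each of the three forms phi_l + phi_m - phi_k, so only the
    alternatives [2 * b] and [2 * c] need an argument. *)
Lemma critical_w_imp (u : Sigma) : critical u -> critical (w u).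
Proof.
destruct (pt_surj u) as (a & b & c & ->).
rewrite w_pt, !critical_pt, !Zcomp_eq_0; intros (H1 & H2 & H3).
assert (N : forall x y, sin x = 0 -> y = - x -> sin y = 0)
  by (intros x y Hx ->; rewrite sin_neg, Hx; ring).
split; [|split].
- destruct H1 as [H|H]; [left; apply (N _ _ H); ring | right; sin_eq_0 H].
- destruct H2 as [H|H]; [left | right; apply (N _ _ H); ring].
  (* The goal is the vanishing of the sine at 2(c - a). Either [2 * a] and [2 * c] are both in PI Z,
     or 2(c - a) = 2(b + c - a) - 2b. *)
  destruct H1 as [K|K].
  + assert (L : sin (2 * c) = 0).
    { destruct H3 as [L|L]; [exact L|].
      sin_eq_0 (sin_minus_eq_0 _ _ (sin_plus_eq_0 _ _ K H) (sin_plus_eq_0 _ _ L L)). }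
    sin_eq_0 (sin_minus_eq_0 _ _ L K).
  + sin_eq_0 (sin_minus_eq_0 _ _ (sin_plus_eq_0 _ _ K K) H).
- destruct H3 as [H|H]; [left | right; apply (N _ _ H); ring].
  destruct H1 as [K|K].
  + assert (L : sin (2 * b) = 0).
    { destruct H2 as [L|L]; [exact L|].
      sin_eq_0 (sin_minus_eq_0 _ _ (sin_plus_eq_0 _ _ K H) (sin_plus_eq_0 _ _ L L)). }
    sin_eq_0 (sin_minus_eq_0 _ _ L K).
  + sin_eq_0 (sin_minus_eq_0 _ _ (sin_plus_eq_0 _ _ K K) H).
Qed.

(** The induction needs an equivalence: the case of an inverse uses the converse direction for
    [f]. *)
Lemma critical_W (f : Sigma -> Sigma) : W f -> forall u, critical (f u) <-> critical u.
Proof.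
induction 1 as [f Hf | | | f g _ IHf _ IHg | f g _ IHf _ Hfg]; intros u.
- now apply critical_perm.
- split; intros H; [rewrite <- (w_involutive u)|]; now apply critical_w_imp.
- reflexivity.
- now rewrite IHf.
- now rewrite <- IHf, Hfg.
Qed.

Lemma critical_W_orbit (A : Sigma -> Prop) (u : Sigma) :
  (forall v, A v -> critical v) -> W_orbit A u -> critical u.
Proof.
intros HA (g & v & Hg & Hv & ->); apply (critical_W _ Hg); auto.
Qed.

Lemma critical_mod_signs (u v : Sigma) :
  eq_mod_signs u v -> critical v -> critical u.
Proof.
destruct (pt_surj v) as (a & b & c & ->), u as [[u1 u2] u3].
assert (D : forall t, sin (2 * (t + PI)) = sin (2 * t)).
{ intros t; replace (2 * (t + PI)) with (2 * t + 2 * INR 1 * PI) by (simpl; ring).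
  apply sin_period. }
(* Adding [PI] to some of the angles shifts phi_l + phi_m - phi_k by -PI, 0, PI or 2 PI. *)
assert (S : forall s t, sin s = 0 -> t = s + PI \/ t = s - PI \/ t = s + 2 * PI -> sin t = 0).
{ intros s t Hs [-> | [-> | ->]]; rewrite ?sin_plus, ?sin_minus, ?sin_2PI, ?sin_PI, Hs; ring. }
simpl; rewrite !copp_expi, critical_pt, !Zcomp_eq_0.
intros ([-> | ->] & [-> | ->] & [-> | ->]) (H1 & H2 & H3);
  match goal with |- critical (expi ?p, expi ?q, expi ?r) => change (critical (pt p q r)) end;
  rewrite critical_pt, !Zcomp_eq_0, ?D;
  (split; [destruct H1 as [H|H] | split; [destruct H2 as [H|H] | destruct H3 as [H|H]]]);
  try (left; exact H); right;
  first [exact H | apply (S _ _ H); first [left; ring | right; left; ring | right; right; ring]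
        | rewrite <- H; f_equal; ring].
Qed.

(** * From zeros to orbits, up to the order of the angles *)

Lemma critical_orbits_perm (f : Sigma -> Sigma) (u : Sigma) :
  coord_perm f -> critical_orbits u -> critical_orbits (f u).
Proof.
intros Hf (v & Huv & Hv); exists (f v); split.
- destruct u as [[u1 u2] u3], v as [[v1 v2] v3], Hf; simpl in *; tauto.
- assert (M : forall A, W_orbit A v -> W_orbit A (f v)).
  { intros A (g & x & Hg & Hx & ->); exists (fun y => f (g y)), x.
    split; [apply W_comp; [now apply W_perm | exact Hg] | now split]. }
  destruct Hv as [Hv | [Hv | Hv]]; auto.
Qed.

Lemma critical_orbits_C_plus (a b c : R) :
  sin (a - b) = 0 -> sin (c - 0) = 0 -> critical_orbits (pt a b c).
Proof.
intros Hab Hc; exists (pt b b 0); split.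
- apply eq_mod_signs_pt; auto; rewrite Rminus_diag; exact sin_0.
- right; left; exists (fun x => x), (pt b b 0).
  split; [exact W_id | split; [exists b, b, 0; auto | easy]].
Qed.

Lemma critical_orbits_C_minus (a b c : R) :
  sin (a - (PI / 2 + c)) = 0 -> sin (b - PI / 2) = 0 -> critical_orbits (pt a b c).
Proof.
intros Ha Hb; exists (pt (PI / 2 + c) (PI / 2) c); split.
- apply eq_mod_signs_pt; auto; rewrite Rminus_diag; exact sin_0.
- right; right; exists (fun x => x), (pt (PI / 2 + c) (PI / 2) c).
  split; [exact W_id | split; [exists (PI / 2 + c), (PI / 2), c; auto | easy]].
Qed.

Lemma critical_orbits_P (a b c : R) :
  sin (a - PI / 2) = 0 -> sin (b - PI / 2) = 0 -> sin (c - PI / 2) = 0 ->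
  critical_orbits (pt a b c).
Proof.
intros Ha Hb Hc; exists pointP; split; [now apply eq_mod_signs_pt|].
left; exists (fun x => x), pointP; split; [exact W_id | easy].
Qed.

(** The angles of [w pointP] are -PI/2, 0, 0, and -PI/2 agrees with PI/2 modulo [PI]. *)
Lemma critical_orbits_wP (a b c : R) :
  sin (a - PI / 2) = 0 -> sin (b - 0) = 0 -> sin (c - 0) = 0 ->
  critical_orbits (pt a b c).
Proof.
intros Ha Hb Hc; exists (w pointP); split.
- unfold pointP; rewrite w_pt; apply eq_mod_signs_pt; rewrite ?Rminus_diag; auto.
  replace (a - - (PI / 2)) with (a - PI / 2 + PI) by field.
  apply sin_plus_eq_0; [exact Ha | exact sin_PI].
- left; exists w, pointP; split; [exact W_w | easy].
Qed.

Lemma critical_orbits_circle (a b c : R) :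
  sin (a + b - c) = 0 -> sin (c + a - b) = 0 -> critical_orbits (pt b c a).
Proof.
intros H1 H2.
assert (H : sin (2 * a) = 0) by sin_eq_0 (sin_plus_eq_0 _ _ H1 H2).
destruct (sin_double_eq_0 _ H) as [K|K].
- apply critical_orbits_C_plus; [|exact K].
  sin_eq_0 (sin_minus_eq_0 _ _ H1 K).
(* [C_minus] has its fixed angle PI/2 in second place, [C_plus] its 0 in third place; hence the swap
   here only. *)
- apply (critical_orbits_perm _ (pt b a c) perm_132).
  apply critical_orbits_C_minus; [|exact K].
  replace (b - (PI / 2 + c)) with (a + b - c - (a - PI / 2) - PI) by field.
  apply sin_minus_eq_0; [apply sin_minus_eq_0; assumption | exact sin_PI].
Qed.

(** The number of angles equal to PI/2 modulo [PI] decides: none or two gives [C_plus], one gives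
    [w pointP], three gives [pointP], up to permutation. *)
Lemma critical_orbits_points (a b c : R) :
  sin (2 * a) = 0 -> sin (2 * b) = 0 -> sin (2 * c) = 0 -> critical_orbits (pt a b c).
Proof.
assert (D : forall x y z, sin (x - z) = 0 -> sin (y - z) = 0 -> sin (x - y) = 0)
  by (intros x y z Hx Hy; sin_eq_0 (sin_minus_eq_0 _ _ Hx Hy)).
intros Ha Hb Hc.
destruct (sin_double_eq_0 _ Ha) as [A|A], (sin_double_eq_0 _ Hb) as [B|B],
  (sin_double_eq_0 _ Hc) as [C|C].
- apply critical_orbits_C_plus; eauto.
- apply (critical_orbits_perm _ (pt c a b) perm_231), critical_orbits_wP; auto.
- apply (critical_orbits_perm _ (pt b a c) perm_213), critical_orbits_wP; auto.
- apply (critical_orbits_perm _ (pt b c a) perm_312), critical_orbits_C_plus; eauto.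
- apply critical_orbits_wP; auto.
- apply (critical_orbits_perm _ (pt a c b) perm_132), critical_orbits_C_plus; eauto.
- apply critical_orbits_C_plus; eauto.
- apply critical_orbits_P; auto.
Qed.

Lemma critical_in_orbits (u : Sigma) : critical u -> critical_orbits u.
Proof.
destruct (pt_surj u) as (a & b & c & ->).
rewrite critical_pt, !Zcomp_eq_0; intros (H1 & H2 & H3).
assert (T : forall x y z, sin (2 * x) = 0 -> sin (2 * y) = 0 ->
    sin (x + y - z) = 0 -> sin (2 * z) = 0).
{ intros x y z X Y Z.
  sin_eq_0 (sin_minus_eq_0 _ _ (sin_plus_eq_0 _ _ X Y) (sin_plus_eq_0 _ _ Z Z)). }
(* With at most one linear condition, [T] supplies the missing doubled angle; with two or three, one
   pair of them yields a circle. *)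
destruct H1 as [A|A], H2 as [B|B], H3 as [C|C].
- now apply critical_orbits_points.
- apply critical_orbits_points; eauto.
- apply critical_orbits_points; eauto.
- apply (critical_orbits_perm _ (pt b c a) perm_312), critical_orbits_circle; assumption.
- apply critical_orbits_points; eauto.
- apply (critical_orbits_perm _ (pt c a b) perm_231), critical_orbits_circle; assumption.
- apply critical_orbits_circle; assumption.
- apply critical_orbits_circle; assumption.
Qed.

(** * The point and the two circles consist of zeros *)

Lemma critical_P : critical pointP.
Proof.
apply critical_pt; rewrite !Zcomp_eq_0.
replace (2 * (PI / 2)) with PI by field; auto using sin_PI.
Qed.

Lemma critical_C_plus (u : Sigma) : C_plus u -> critical u.
Proof.
intros (p1 & p2 & p3 & -> & -> & ->).
apply critical_pt; rewrite !Zcomp_eq_0.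
split; [right | split; [right | left]].
- replace (p2 + 0 - p2) with 0 by ring; exact sin_0.
- replace (0 + p2 - p2) with 0 by ring; exact sin_0.
- rewrite Rmult_0_r; exact sin_0.
Qed.

Lemma critical_C_minus (u : Sigma) : C_minus u -> critical u.
Proof.
intros (p1 & p2 & p3 & -> & -> & ->).
apply critical_pt; rewrite !Zcomp_eq_0.
split; [right | split; [left | right]].
- rewrite <- sin_0; f_equal; field.
- rewrite <- sin_PI; f_equal; field.
- rewrite <- sin_PI; f_equal; field.
Qed.

Theorem corollary1 (u : Sigma) :
  critical u <->
  exists v : Sigma,
    eq_mod_signs u v /\
    (W_orbit (fun x : Sigma => x = pointP) v \/ W_orbit C_plus v \/ W_orbit C_minus v).
Proof.
split; [exact (critical_in_orbits u)|].
intros (v & Huv & Hv); apply (critical_mod_signs _ _ Huv).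
destruct Hv as [Hv | [Hv | Hv]]; revert Hv; apply critical_W_orbit.
- intros x ->; exact critical_P.
- exact critical_C_plus.
- exact critical_C_minus.
Qed.
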